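(* Let $\mu,\nu\in\mathcal{P}([0,1])$ with $\mu(dx)=\rho_\mu(x)\,dx$ and $\nu(dx)=\rho_\nu(x)\,dx$, where $\rho_\mu,\rho_\nu\in L^\infty([0,1],dx;\mathbb{R}_+)$. For all $N\in\mathbb{N}^*$, let $I^N$ be the infimum of $\int_{[0,1]^2}(x-y)^2\,d\pi(x,y)$ over all $\pi\in\mathcal{P}([0,1]^2)$ such that for all $1\le m\le N$ and $l\in\{1,2\}$, $$\int_{[0,1]^2}\phi^N_{m,l}(x)\,d\pi(x,y)=\int_{[0,1]}\phi^N_{m,l}\,d\mu\quad\text{and}\quad\int_{[0,1]^2}\phi^N_{m,l}(y)\,d\pi(x,y)=\int_{[0,1]}\phi^N_{m,l}\,d\nu.$$ Then $$I^N\le W_2^2(\mu,\nu)\le I^N+\frac73\,\frac{\|\rho_\mu\|_\infty+\|\rho_\nu\|_\infty}{N^2}.$$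
   Context: $\mathbb{N}^*=\{1,2,\dots\}$, $\mathbb{R}_+=[0,+\infty)$. For $N\in\mathbb{N}^*$, $T^N_1=[0,\frac1N]$ and $T^N_m=(\frac{m-1}{N},\frac mN]$ for $2\le m\le N$. $\mathcal{P}(E)$ is the set of Borel probability measures on $E$. The test functions on $[0,1]$ are the discontinuous piecewise affine functions $\phi^N_{m,1}(x)=N\left(x-\frac{m-1}{N}\right)$ if $x\in T^N_m$, $0$ otherwise; $\phi^N_{m,2}(x)=1-N\left(x-\frac{m-1}{N}\right)$ if $x\in T^N_m$, $0$ otherwise, for $1\le m\le N$. $W_2^2(\mu,\nu)=\inf\int|x-y|^2\,d\pi(x,y)$ over probability measures $\pi$ on $[0,1]^2$ with marginals $\mu$ and $\nu$. *)

(* Defs.v *)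
From HB Require Import structures.
From mathcomp Require Import all_boot all_order all_algebra.
From mathcomp Require Import all_classical all_reals all_analysis.

Set Implicit Arguments.
Unset Strict Implicit.
Unset Printing Implicit Defensive.

Import Order.TTheory GRing.Theory Num.Theory.
Import numFieldNormedType.Exports.

Local Open Scope classical_set_scope.
Local Open Scope ring_scope.

Definition unit_itv (R : realType) : set (measurableTypeR R) := `[0, 1]%classic.

Arguments unit_itv R : clear implicits.

Definition unit_square (R : realType)
    : set (measurableTypeR R * measurableTypeR R)%type :=
  unit_itv R `*` unit_itv R.

Arguments unit_square R : clear implicits.

(* P(E) is encoded by the probability measures on the ambient space that are
   carried by E: a Borel probability measure on E is identified with its image
   under the inclusion. *)
Definition probability_on (d : measure_display) (T : measurableType d)
    (R : realType) (E : set T) : set (probability T R) :=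
  [set P | P E = 1%E].

Definition lebesgue01 (R : realType)
    : {measure set (measurableTypeR R) -> \bar R} :=
  mrestr lebesgue_measure (measurable_itv `[0 : R, 1]).

Arguments lebesgue01 R : clear implicits.

Definition Linfty_norm (R : realType) (rho : measurableTypeR R -> R) : \bar R :=
  'N[lebesgue01 R]_+oo[EFin \o rho]%E.

(* L^oo([0, 1], dx; R_+); the values of rho outside [0, 1] play no role. *)
Definition nonneg_Linfty (R : realType) (rho : measurableTypeR R -> R) : Prop :=
  [/\ measurable_fun (unit_itv R) rho,
      forall x, unit_itv R x -> 0 <= rho x &
      finite_norm (lebesgue01 R) +oo%E rho].

Definition has_density (R : realType) (mu : probability (measurableTypeR R) R)
    (rho : measurableTypeR R -> R) : Prop :=
  forall A : set (measurableTypeR R), measurable A -> A `<=` unit_itv R ->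
    mu A = (\int[lebesgue_measure]_(x in A) (rho x)%:E)%E.

(* T^N_m for 1 <= m <= N; only the first cell contains its left end point. *)
Definition cell (R : realType) (N m : nat) : set R :=
  if m == 1%N then `[0, 1 / N%:R]%classic
  else `](m%:R - 1) / N%:R, m%:R / N%:R]%classic.

Arguments cell R N m : clear implicits.

Definition phi1 (R : realType) (N m : nat) (x : R) : R :=
  if x \in cell R N m then N%:R * (x - (m%:R - 1) / N%:R) else 0.

Definition phi2 (R : realType) (N m : nat) (x : R) : R :=
  if x \in cell R N m then 1 - N%:R * (x - (m%:R - 1) / N%:R) else 0.

(* phi^N_{m,l}, only meant for l = 1 and l = 2. *)
Definition phi (R : realType) (N m l : nat) (x : R) : R :=
  if l == 1%N then phi1 N m x else phi2 N m x.

Definition cost (R : realType)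
    (pi : probability (measurableTypeR R * measurableTypeR R)%type R) : \bar R :=
  (\int[pi]_(z in unit_square R) ((z.1 - z.2) ^+ 2)%:E)%E.

Definition couplings (R : realType) (mu nu : probability (measurableTypeR R) R)
    : set (probability (measurableTypeR R * measurableTypeR R)%type R) :=
  [set pi | [/\ probability_on (unit_square R) pi,
      forall A, measurable A -> pushforward pi fst A = mu A &
      forall A, measurable A -> pushforward pi snd A = nu A]].

Definition moment_couplings (R : realType) (N : nat)
    (mu nu : probability (measurableTypeR R) R)
    : set (probability (measurableTypeR R * measurableTypeR R)%type R) :=
  [set pi | probability_on (unit_square R) pi /\
    forall m l : nat, (1 <= m <= N)%N -> l \in [:: 1%N; 2%N] ->
      (\int[pi]_(z in unit_square R) (phi N m l z.1)%:E
        = \int[mu]_(x in unit_itv R) (phi N m l x)%:E)%E /\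
      (\int[pi]_(z in unit_square R) (phi N m l z.2)%:E
        = \int[nu]_(y in unit_itv R) (phi N m l y)%:E)%E].

Definition W2sq (R : realType) (mu nu : probability (measurableTypeR R) R)
    : \bar R :=
  ereal_inf [set cost pi | pi in couplings mu nu].

Definition I_MCOT (R : realType) (N : nat)
    (mu nu : probability (measurableTypeR R) R) : \bar R :=
  ereal_inf [set cost pi | pi in moment_couplings N mu nu].

(* Main.v *)
Require Import Defs.
From HB Require Import structures.
From mathcomp Require Import all_boot all_order all_algebra.
From mathcomp Require Import all_classical all_reals all_analysis.
From mathcomp Require Import measurable_realfun ess_sup_inf ring lra.

Set Implicit Arguments.
Unset Strict Implicit.
Unset Printing Implicit Defensive.

Import Order.TTheory GRing.Theory Num.Theory.
Import numFieldNormedType.Exports.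

Local Open Scope classical_set_scope.
Local Open Scope ring_scope.

(* Let T be the monotone map pushing mu to nu, f a primitive of T and g the
   convex conjugate of f on [0, 1]: then x y <= f x + g y, with equality on the
   graph of T. Hence, with q_f x = x^2 - 2 f x, the monotone plan costs exactly
   int q_f dmu + int q_g dnu, while any plan pi costs at least the integrals of
   q_f and q_g against its own marginals. These marginals have the same moments
   as mu and nu, and on each cell q_f lies between two affine functions, whose
   gap is a constant 1 / (4 N^2) coming from x^2 plus 2 / N times the increment
   of T over the cell coming from f. Cells have mass at most
   ||rho_mu||_oo / N and the increments of T add up to at most 1, so each
   marginal costs (2 ||rho||_oo + 1/4) / N^2, and 1 <= ||rho||_oo. *)

Lemma bounded_integrable d (T : measurableType d) (R : realType)
    (mu : {measure set T -> \bar R}) (A : set T) (f : T -> R) (K : R) :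
  measurable A -> (mu A < +oo)%E -> measurable_fun A f ->
  (forall x, A x -> `|f x| <= K) -> mu.-integrable A (EFin \o f).
Proof.
move=> mA Afin mf fK; apply: measurable_bounded_integrable => //.
exists K; split; first exact: num_real.
by move=> M KM x /= Ax; rewrite (le_trans (fK x Ax))// ltW.
Qed.

(** * Convex functions on [0, 1] with slopes in [0, 1], and their conjugates *)

Section subgradient.
Context {R : realType}.
Implicit Types (f T : R -> R).

(** Convexity of [f] is recorded through a monotone selection [T] of its subdifferential. With
    slopes in [0, 1], the class is stable under conjugation on [0, 1], which exchanges points and
    slopes. *)
Definition subgradient f T :=
  [/\ forall x, 0 <= x <= 1 -> 0 <= T x <= 1,
      forall x y, 0 <= x <= 1 -> 0 <= y <= 1 -> x < y -> T x <= T y &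
      forall x z, 0 <= x <= 1 -> 0 <= z <= 1 -> f x + T x * (z - x) <= f z].

(** The subgradient inequalities at [x] and at [z] bound the increment from both sides, by slopes in
    [0, 1]. *)
Lemma subgradient_lipschitz f T : subgradient f T ->
  forall x z, 0 <= x <= 1 -> 0 <= z <= 1 -> `|f x - f z| <= `|x - z|.
Proof.
move=> [T01 _ fT] x z x01 z01.
wlog xz : x z x01 z01 / x <= z.
  move=> H; have [/H|/ltW/H] := leP x z; first exact.
  by rewrite distrC (distrC z); exact.
have := fT x z x01 z01; have := fT z x z01 x01.
have := T01 x x01; have := T01 z z01.
rewrite (distrC x) (ger0_norm (_ : 0 <= z - x)) ?subr_ge0// ler_norml.
by move=> *; apply/andP; split; nra.
Qed.

Lemma lipschitz_within_continuous f (a b k : R) : 0 <= k ->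
  (forall x z, a <= x <= b -> a <= z <= b -> `|f x - f z| <= k * `|x - z|) ->
  {within `[a, b], continuous f}.
Proof.
move=> k0 fk; apply/subspace_continuousP => x; rewrite /= in_itv/= => xab.
apply/cvgrPdist_le => e e0; rewrite near_withinE; near=> y.
rewrite /= in_itv/= => yab; apply: (le_trans (fk _ _ xab yab)).
(* Since [k] may be 0, the radius is taken as [e / (k + 1)]. *)
rewrite (@le_trans _ _ ((k + 1) * `|x - y|))// ?ler_wpM2r ?lerDl//.
rewrite mulrC -ler_pdivlMr; last by rewrite ltr_pwDr.
near: y; apply: cvgr_dist_le; first exact: cvg_id.
by rewrite divr_gt0// ltr_pwDr.
Unshelve. all: by end_near. Qed.

Lemma subgradient_continuous f T : subgradient f T ->
  {within `[0, 1], continuous f}.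
Proof.
move=> fT; apply: (@lipschitz_within_continuous _ _ _ 1) => // x z x01 z01.
by rewrite mul1r; exact: subgradient_lipschitz fT _ _ x01 z01.
Qed.

Lemma subgradient_measurable f T : subgradient f T ->
  measurable_fun (unit_itv R) f.
Proof.
move=> /subgradient_continuous; apply: subspace_continuous_measurable_fun.
exact: measurable_itv.
Qed.

(** By compactness [z * y - f z] has a maximizer [S y] on [0, 1]. The maximum is [g y], and the
    maximizer is a subgradient of [g] at [y]. *)
Lemma subgradient_conjugate f T : subgradient f T -> exists g S,
  [/\ subgradient g S,
      forall x y, 0 <= x <= 1 -> 0 <= y <= 1 -> x * y <= f x + g y &
      forall x, 0 <= x <= 1 -> f x + g (T x) = x * T x].
Proof.
move=> fT; have [T01 Tnd fTle] := fT.
have : forall y, exists x, 0 <= x <= 1 /\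
    forall z, 0 <= z <= 1 -> z * y - f z <= x * y - f x.
  move=> y; have [|x x01 xmax] := @EVT_max R (fun x => x * y - f x) 0 1 ler01.
  - have yf x z : 0 <= x <= 1 -> 0 <= z <= 1 ->
        `|x * y - f x - (z * y - f z)| <= (`|y| + 1) * `|x - z|.
      move=> x01 z01; rewrite [X in `|X|](_ : _ = (x - z) * y - (f x - f z)).
        rewrite (le_trans (ler_normB _ _))// normrM mulrDl mul1r mulrC lerD2l.
        exact: subgradient_lipschitz fT _ _ x01 z01.
      by ring.
    exact: lipschitz_within_continuous yf.
  - exists x; split=> [|z z01]; first by move: x01; rewrite in_itv.
    by apply: xmax; rewrite in_itv.
move=> /choice[S HS]; exists (fun y => S y * y - f (S y)), S.
have S01 y : 0 <= S y <= 1 by case: (HS y).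
have Smax y z : 0 <= z <= 1 -> z * y - f z <= S y * y - f (S y).
  by case: (HS y) => _; exact.
split; last 2 first.
- by move=> x y x01 _; rewrite -lerBlDl; exact: Smax.
(* The subgradient inequality at [x] says that [x] itself maximizes [z * T x - f z]. *)
- move=> x x01; apply/eqP; rewrite eq_le; apply/andP; split.
    by have := fTle x _ x01 (S01 (T x)); lra.
  by rewrite -lerBlDl; exact: Smax.
- split=> [//|x y x01 y01 xy|x z x01 z01].
    (* Adding the two optimality inequalities gives [0 <= (S y - S x) * (y - x)]. *)
    by have := Smax x _ (S01 y); have := Smax y _ (S01 x); nra.
  by have := Smax z _ (S01 x); nra.
Qed.

(** Take the integral of [T] from 0. Between [x] and [z], [T] is at least [T x] when [x <= z] and at
    most [T x] when [z <= x]; in the second case the sign of the increment flips as well. *)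
Lemma monotone_primitive T : nondecreasing_fun T ->
  (forall x, 0 <= T x <= 1) -> exists f, subgradient f T.
Proof.
move=> Tnd T01; pose mu := @lebesgue_measure R.
exists (fun x => \int[mu]_(t in `[0, x]) T t).
have mT (D : set R) : measurable D -> measurable_fun D T.
  by move=> mD; exact: nondecreasing_measurable.
have muoc (x z : R) : x <= z -> mu `]x, z]%classic = (z - x)%:E.
  by move=> xz; rewrite /mu lebesgue_measure_itv/= lte_fin lt_neqAle xz andbT;
    case: eqVneq => [->|]; rewrite ?subrr// EFinB.
have mucc (x z : R) : x <= z -> mu `[x, z]%classic = (z - x)%:E.
  by move=> xz; rewrite /mu lebesgue_measure_itv/= lte_fin lt_neqAle xz andbT;
    case: eqVneq => [->|]; rewrite ?subrr// EFinB.
have muocy (x z : R) : x <= z -> (mu `]x, z]%classic < +oo)%E.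
  by move=> xz; rewrite muoc// ltry.
have intT (D : set R) : measurable D -> (mu D < +oo)%E ->
    mu.-integrable D (EFin \o T).
  move=> mD Dfin; apply: (@bounded_integrable _ _ _ _ _ _ 1) => //.
    exact: mT.
  by move=> x _; have /andP[T0 T1] := T01 x; rewrite ger0_norm.
have diff (x z : R) : 0 <= x -> x <= z -> \int[mu]_(t in `[0, z]) T t -
    \int[mu]_(t in `[0, x]) T t = \int[mu]_(t in `]x, z]) T t.
  move=> x0 xz; apply: Rintegral_itvB; rewrite ?bnd_simp//.
  by apply: intT => //; rewrite mucc ?ltry// (le_trans x0).
split=> [//|x y _ _ xy|x z x01 z01]; first exact/Tnd/ltW.
have intToc (a b : R) : a <= b -> mu.-integrable `]a, b] (EFin \o T).
  by move=> ab; apply: intT => //; exact: muocy.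
have intc (a b c : R) : a <= b -> \int[mu]_(t in `]a, b]) c = c * (b - a).
  by move=> ab; rewrite Rintegral_cst//; congr (_ * _);
    exact: (congr1 fine (muoc a b ab)).
have intcst (a b c : R) : a <= b -> mu.-integrable `]a, b] (EFin \o cst c).
  move=> ab; apply: (@bounded_integrable _ _ _ _ _ _ `|c|) => //.
  exact: muocy.
have [xz|/ltW zx] := leP x z.
- rewrite -lerBrDl diff//; last by case/andP: x01.
  rewrite -intc//; apply: le_Rintegral => //.
  + exact: intcst.
  + exact: intToc.
  + by move=> t; rewrite /= in_itv/= => /andP[xt _]; exact/Tnd/ltW.
- rewrite -lerBrDl -lerN2 opprB diff//; last by case/andP: z01.
  rewrite -mulrN opprB -intc//; apply: le_Rintegral => //.
  + exact: intToc.
  + exact: intcst.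
  + by move=> t; rewrite /= in_itv/= => /andP[_ tx]; exact/Tnd.
Qed.

End subgradient.

Lemma Rintegral_sum d (T : measurableType d) (R : realType)
    (mu : {measure set T -> \bar R}) (D : set T) (n : nat)
    (F : 'I_n -> T -> R) :
  measurable D -> (forall i, mu.-integrable D (EFin \o F i)) ->
  \int[mu]_(x in D) (\sum_(i < n) F i x) =
  \sum_(i < n) \int[mu]_(x in D) F i x.
Proof.
move=> mD iF; rewrite /Rintegral; under eq_integral do rewrite -sumEFin.
rewrite integral_sum// sum_fine// => i _.
exact: (integrable_fin_num mD (iF i)).
Qed.

(** * Cells and test functions in local coordinates *)

Section cells.
Context {R : realType}.
Variable N : nat.
Hypothesis N_gt0 : (0 < N)%N.

(** Scaling by [N] gives integer end points. Cells are numbered from 1, hence [m.+1], and the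
    disjunct [m == 0] reflects the closed left end of the first one. *)
Lemma in_cellS (m : nat) (x : R) : 0 <= x -> (x \in cell R N m.+1) =
  ((m == 0%N) || (m%:R < N%:R * x)) && (N%:R * x <= m.+1%:R).
Proof.
move=> x0; have NR : 0 < N%:R :> R by rewrite ltr0n.
rewrite /cell; case: m => [|m]; rewrite mem_setE in_itv/=.
  by rewrite x0/= ler_pdivlMr// mulrC.
have -> : m.+2%:R - 1 = m.+1%:R :> R by rewrite -natr1 addrK.
by rewrite ltr_pdivrMr// ler_pdivlMr// mulrC.
Qed.

(* The cell number is the least [n] with [N x <= n], except at [x = 0]. *)
Lemma phi_coord (x : R) : 0 <= x <= 1 -> exists (k : 'I_N) (t : R),
  [/\ 0 <= t <= 1, x = (k%:R + t) / N%:R,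
      forall m : 'I_N, phi N m.+1 1 x = (m == k)%:R * t &
      forall m : 'I_N, phi N m.+1 2 x = (m == k)%:R * (1 - t)].
Proof.
move=> /andP[x0 x1]; have NR : 0 < N%:R :> R by rewrite ltr0n.
have NxN : N%:R * x <= N%:R by rewrite ler_piMr// ltW.
have ex : exists n, N%:R * x <= n%:R by exists N.
case: (ex_minnP ex) => n Nxn nmin.
have nN : (n <= N)%N := nmin _ NxN.
have kN : (n.-1 < N)%N by case: n nN {Nxn nmin}.
(* If [n = 0], that is [x = 0], then [n.-1] is still 0 and [x] falls in the first cell. *)
have kx : (n.-1 == 0%N) || (n.-1%:R < N%:R * x).
  case: n Nxn nmin {nN kN} => [|[|n]]//= _ nmin; rewrite ltNge; apply/negP.
  by move=> /nmin; rewrite ltnn.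
have xk : N%:R * x <= n.-1.+1%:R by rewrite (le_trans Nxn)// ler_nat leqSpred.
have cellE (m : 'I_N) : (x \in cell R N m.+1) = (m == Ordinal kN).
  rewrite in_cellS// -val_eqE/=; case: (ltngtP m n.-1) => [mn|nm|->].
  - rewrite [X in _ && X]leNgt (_ : m.+1%:R < _) ?andbF//.
    case/orP: kx => [/eqP n0|]; first by rewrite n0 in mn.
    by apply: le_lt_trans; rewrite ler_nat.
  - rewrite (gtn_eqF (leq_ltn_trans (leq0n _) nm))/= ltNge.
    by rewrite [X in ~~ X](le_trans xk) ?ler_nat.
  - by rewrite kx xk.
exists (Ordinal kN), (N%:R * x - n.-1%:R); split => /=.
- apply/andP; split; last by rewrite lerBlDr -natr1 in xk *; lra.
  rewrite subr_ge0; case/orP: kx => [/eqP ->|/ltW//].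
  by rewrite mulr_ge0// ltW.
- by rewrite addrC subrK mulrC mulKf// gt_eqF.
- move=> m; rewrite /phi /phi1 cellE; case: (eqVneq m) => [->|_];
    last by rewrite mul0r.
  by rewrite mul1r/= -natr1 addrK mulrBr mulrCA divff ?mulr1// gt_eqF.
- move=> m; rewrite /phi /phi2 cellE; case: (eqVneq m) => [->|_];
    last by rewrite mul0r.
  by rewrite mul1r/= -natr1 addrK mulrBr mulrCA divff ?mulr1// gt_eqF.
Qed.

Lemma measurable_cell m : measurable (cell R N m).
Proof. by rewrite /cell; case: ifP. Qed.

Lemma measurable_phi m l : measurable_fun [set: R] (phi N m l).
Proof.
(* Both test functions are, by conversion, restrictions of affine functions to the cell. *)
have cellT (f : R -> R) : measurable_fun setT f ->
    measurable_fun setT (f \_ (cell R N m)).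
  by move=> mf; apply/(measurable_restrictT f (measurable_cell m));
    exact: measurable_funTS.
have mN (c : R) : measurable_fun [set: R] (fun x => N%:R * (x - c)).
  by apply: measurable_funM => //; apply: measurable_funB.
rewrite /phi; case: (l == 1%N); first exact: (cellT _ (mN ((m%:R - 1) / N%:R))).
have mB : measurable_fun [set: R] (fun x => 1 - N%:R * (x - (m%:R - 1) / N%:R)).
  by apply: measurable_funB => //; exact: mN.
exact: (cellT _ mB).
Qed.
End cells.

(** * Stability of integrals of [quad f] under equality of moments *)

Section moment_stability.
Context {R : realType}.
Variable N : nat.
Hypothesis N_gt0 : (0 < N)%N.

(** The general element of the span of the test functions: on each cell, affine with [be m] as limit
    at the left end and [al m] as value at the right end. Jumps between cells are allowed. *)
Definition simple_affine (al be : nat -> R) (x : R) : R :=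
  \sum_(m < N) (al m * phi N m.+1 1 x + be m * phi N m.+1 2 x).

Lemma simple_affineE al be (x : R) : 0 <= x <= 1 ->
  exists (k : 'I_N) (t : R), [/\ 0 <= t <= 1, x = (k%:R + t) / N%:R &
    simple_affine al be x = al k * t + be k * (1 - t)].
Proof.
move=> /(phi_coord N_gt0)[k [t [t01 xE p1 p2]]]; exists k, t; split=> //.
rewrite /simple_affine (bigD1 k)//= p1 p2 eqxx !mul1r big1 ?addr0// => m mk.
by rewrite p1 p2 (negbTE mk) !mul0r !mulr0 addr0.
Qed.

(** A Kantorovich potential for the quadratic cost: [x * y <= f x + g y] amounts to
    [quad f x + quad g y <= (x - y) ^+ 2]. *)
Definition quad (f : R -> R) (x : R) : R := x ^+ 2 - 2 * f x.

Definition node (m : nat) : R := m%:R / N%:R.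

Lemma node01 m : (m <= N)%N -> 0 <= node m <= 1.
Proof.
move=> mN; have NR : 0 < N%:R :> R by rewrite ltr0n.
by rewrite /node divr_ge0//= ler_pdivrMr// mul1r ler_nat.
Qed.

Lemma nodeS m : node m.+1 = node m + N%:R^-1.
Proof. by rewrite /node -natr1 mulrDl mul1r. Qed.

Lemma measurable_quad f T : subgradient f T ->
  measurable_fun (unit_itv R) (quad f).
Proof.
move=> fT; rewrite /quad; apply: measurable_funB.
  by apply: (measurable_funX 2); exact: measurable_id.
by apply: measurable_funM => //; exact: subgradient_measurable fT.
Qed.

Lemma quad_bound f T : subgradient f T ->
  forall x, 0 <= x <= 1 -> `|quad f x| <= 1 + 2 * (`|f 0| + 1).
Proof.
move=> fT x /[dup] x01 /andP[x0 x1].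
have := subgradient_lipschitz fT x01 (_ : 0 <= 0 <= 1); rewrite lexx ler01.
move=> /(_ isT); rewrite subr0 (ger0_norm x0) => fx.
rewrite /quad (le_trans (ler_normB _ _))// lerD//.
  by rewrite ger0_norm ?exprn_ge0// exprn_ile1.
rewrite normrM (ger0_norm (ler0n _ 2)) ler_wpM2l//.
rewrite -(subrK (f 0) (f x)) addrC (le_trans (ler_normD _ _))// lerD2l.
exact: le_trans fx _.
Qed.

(* On each cell [x ^+ 2] lies between its chord minus [1 / (4 N^2)] and its
   chord, and [f] between its two tangent slopes at the ends of the cell. *)
Definition quad_cst (f : R -> R) (m : nat) : R := quad f (node m).
(** The coefficient at the right end of the cell, with [f] replaced there by the line of slope [s]
    through its value at the left end. *)
Definition quad_lin (f : R -> R) (m : nat) (s : R) : R :=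
  node m.+1 ^+ 2 - 2 * (f (node m) + s / N%:R).

Lemma quad_le (f T : R -> R) (x : R) : subgradient f T -> 0 <= x <= 1 ->
  quad f x <=
    simple_affine (fun m => quad_lin f m (T (node m))) (quad_cst f) x.
Proof.
move=> [T01 Tnd fT] x01.
have [k [t [t01 xE ->]]] := simple_affineE
  (fun m => quad_lin f m (T (node m))) (quad_cst f) x01.
have k01 := node01 (ltnW (ltn_ord k)).
have := fT (node k) x k01 x01.
rewrite /quad_lin /quad_cst /quad nodeS; move: k01; rewrite /node.
have : 0 < N%:R^-1 :> R by rewrite invr_gt0 ltr0n.
have {}xE : x = k%:R / N%:R + t * N%:R^-1 by rewrite xE mulrDl.
rewrite xE; set v := N%:R^-1; set a := k%:R * v; set F := f _; set G := f a.
set S := T a; move=> v0 a01 H.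
(* This is the gap between the chord of the square and the square. *)
have : 0 <= t * (1 - t) * v ^+ 2.
  by case/andP: t01 => t0 t1; rewrite !mulr_ge0 ?exprn_ge0 ?subr_ge0// ltW.
nra.
Qed.

Lemma quad_ge (f T : R -> R) (x : R) : subgradient f T -> 0 <= x <= 1 ->
  simple_affine (fun m => quad_lin f m (T (node m.+1))) (quad_cst f) x
    <= quad f x + (4 * N%:R ^+ 2)^-1.
Proof.
move=> [T01 Tnd fT] x01.
have [k [t [t01 xE ->]]] := simple_affineE
  (fun m => quad_lin f m (T (node m.+1))) (quad_cst f) x01.
have k01 := node01 (ltnW (ltn_ord k)).
have k01' := node01 (ltn_ord k).
have v0 : 0 < N%:R^-1 :> R by rewrite invr_gt0 ltr0n.
have {}xE : x = node k + t * N%:R^-1 by rewrite xE mulrDl.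
(* The tangent at [x] is read at the left node, with [T x <= T (node k.+1)]. The right end [t = 1]
   is separate, since monotonicity of [T] is stated for distinct points. *)
have fx : f x <= f (node k) + T (node k.+1) * (t * N%:R^-1).
  case/andP: t01 => t0; rewrite le_eqVlt => /predU1P[t1|t1].
    have xk : x = node k.+1 by rewrite xE t1 mul1r nodeS.
    have := fT x (node k) x01 k01; rewrite t1 mul1r -xk xE t1 mul1r; lra.
  have xk : x < node k.+1 by rewrite xE nodeS ltrD2l gtr_pMl.
  have := Tnd _ _ x01 k01' xk.
  have := fT x (node k) x01 k01.
  have : 0 <= t * N%:R^-1 by rewrite mulr_ge0// ltW.
  have -> : node k - x = - (t * N%:R^-1) by rewrite xE opprD addNKr.
  nra.
rewrite /quad_lin /quad_cst /quad invfM -exprVn.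
rewrite nodeS in fx *; rewrite xE in fx *.
move: fx; set v := N%:R^-1; set F := f _; set G := f _; set S := T _.
(* This gives [t * (1 - t) <= 1 / 4], whence the constant 1 / (4 N^2). *)
have := sqr_ge0 ((2 * t - 1) * v).
nra.
Qed.


(** * Integrals of functions of a [0, 1]-valued variable [X], later the identity or a coordinate of
    a plan *)

Section integrals.
Context d (Y : measurableType d) (P : {measure set Y -> \bar R}).
Variables (E : set Y) (X : Y -> R).
Hypotheses (mE : measurable E) (PE : P E = 1%E) (mX : measurable_fun E X).
Hypothesis X01 : forall y, E y -> 0 <= X y <= 1.

Let PEy : (P E < +oo)%E. Proof. by rewrite PE ltry. Qed.

Lemma phi01 (m : 'I_N) l (x : R) : 0 <= x <= 1 -> l \in [:: 1; 2]%N ->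
  0 <= phi N m.+1 l x <= 1.
Proof.
move=> /(phi_coord N_gt0)[k [t [/andP[t0 t1] xE p1 p2]]].
rewrite !inE => /orP[] /eqP ->; rewrite (p1, p2); case: (m == k);
  by rewrite ?mul1r ?mul0r ?lexx ?ler01 ?t0//=; lra.
Qed.

Lemma integrable_phi (m : 'I_N) l : l \in [:: 1; 2]%N ->
  P.-integrable E (EFin \o (phi N m.+1 l \o X)).
Proof.
move=> l12; apply: (@bounded_integrable _ _ _ _ _ _ 1) => //.
  by apply: measurableT_comp mX; exact: measurable_phi.
move=> y /X01 /(@phi01 m l)/(_ l12)/andP[p0 p1].
by rewrite ger0_norm.
Qed.

Lemma integrable_quad f T : subgradient f T ->
  P.-integrable E (EFin \o (quad f \o X)).
Proof.
move=> fT.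
apply: (@bounded_integrable _ _ _ _ _ _ (1 + 2 * (`|f 0| + 1))) => //.
  apply: (measurable_comp _ _ (measurable_quad fT) mX).
    exact: measurable_itv.
  by move=> _ [y Ey <-]; rewrite /unit_itv/= in_itv/=; exact: X01.
by move=> y /X01 Xy; exact: quad_bound fT _ Xy.
Qed.

Lemma integrable_simple_affine al be :
  P.-integrable E (EFin \o (simple_affine al be \o X)).
Proof.
have -> : EFin \o (simple_affine al be \o X) = fun y => (\sum_(m < N)
    ((al m)%:E * (phi N m.+1 1 (X y))%:E +
     (be m)%:E * (phi N m.+1 2 (X y))%:E))%E.
  by apply/funext => y; rewrite /= /simple_affine -sumEFin.
apply: integrable_sum => // m _.
by apply: integrableD => //; apply: integrableZl => //;
  [exact: (@integrable_phi m 1)|exact: (@integrable_phi m 2)].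
Qed.

Lemma Rintegral_simple_affine al be :
  \int[P]_(y in E) simple_affine al be (X y) =
  \sum_(m < N) (al m * \int[P]_(y in E) phi N m.+1 1 (X y) +
                be m * \int[P]_(y in E) phi N m.+1 2 (X y)).
Proof.
have i1 (m : 'I_N) l c : l \in [:: 1; 2]%N ->
    P.-integrable E (EFin \o (fun y => c * phi N m.+1 l (X y))).
  move=> l12.
  rewrite (_ : _ \o _ = fun y => (c%:E * (phi N m.+1 l (X y))%:E)%E)//.
  by apply: integrableZl => //; exact: integrable_phi.
rewrite Rintegral_sum//; last first.
  move=> m; rewrite (_ : _ \o _ = (fun y => (al m * phi N m.+1 1 (X y))%:E +
    (be m * phi N m.+1 2 (X y))%:E)%E)//.
  by apply: integrableD => //; apply: i1; rewrite !inE.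
apply: eq_bigr => m _; rewrite RintegralD//; try by apply: i1; rewrite !inE.
by rewrite !RintegralZl//;
  [exact: (@integrable_phi m 2)|exact: (@integrable_phi m 1)].
Qed.

End integrals.


(** The test function is at most 1 and vanishes off its cell. This bounds the weight of a change in
    a right end coefficient. *)
Lemma Rintegral_phi1_le (mu : {measure set (measurableTypeR R) -> \bar R})
    (m : 'I_N) : mu (unit_itv R) = 1%E ->
  \int[mu]_(x in unit_itv R) phi N m.+1 1 x <=
    fine (mu (unit_itv R `&` cell R N m.+1)).
Proof.
move=> mu1; have mC := measurable_cell N (R := R) m.+1.
have mI : measurable (unit_itv R) by exact: measurable_itv.
have mIC := measurableI _ _ mI mC.
have ICy : (mu (unit_itv R `&` cell R N m.+1) < +oo)%E.
  by rewrite (@le_lt_trans _ _ 1%E) ?ltry// -mu1 le_measure// inE.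
pose lin (x : R) : R := N%:R * (x - (m.+1%:R - 1) / N%:R).
have -> : \int[mu]_(x in unit_itv R) phi N m.+1 1 x =
    \int[mu]_(x in unit_itv R `&` cell R N m.+1) lin x.
  by rewrite Rintegral_mkcondr.
rewrite -[leRHS]mul1r -Rintegral_cst//.
have linphi x : (unit_itv R `&` cell R N m.+1) x -> 0 <= lin x <= 1.
  rewrite {1}/unit_itv/= in_itv/= => -[x01 Cx].
  by have := @phi01 m 1 x x01 isT; rewrite /phi /phi1/= mem_set.
apply: le_Rintegral => //.
- apply: (@bounded_integrable _ _ _ _ _ _ 1) => //.
    by apply: measurable_funM => //; exact: measurable_funB.
  by move=> x /linphi/andP[l0 l1]; rewrite ger0_norm.
- by apply: (@bounded_integrable _ _ _ _ _ _ 1) => // x _; rewrite /= normr1.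
- by move=> x /linphi/andP[].
Qed.

(** Bound [quad f] above under [mu] and below under [P] by elements of the span of the test
    functions. Both measures integrate this span equally, so only the difference of the two sets of
    coefficients remains. *)
Lemma moment_stability d (Y : measurableType d) (P : {measure set Y -> \bar R})
    (E : set Y) (X : Y -> R) (mu : {measure set (measurableTypeR R) -> \bar R})
    (f T : R -> R) (M : R) :
  subgradient f T -> measurable E -> P E = 1%E -> measurable_fun E X ->
  (forall y, E y -> 0 <= X y <= 1) -> mu (unit_itv R) = 1%E ->
  (forall m : 'I_N, fine (mu (unit_itv R `&` cell R N m.+1)) <= M / N%:R) ->
  (forall (m : 'I_N) l, l \in [:: 1; 2]%N ->
    \int[P]_(y in E) phi N m.+1 l (X y) =
    \int[mu]_(x in unit_itv R) phi N m.+1 l x) ->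
  \int[mu]_(x in unit_itv R) quad f x <=
    \int[P]_(y in E) quad f (X y) + (2 * M + 4^-1) / N%:R ^+ 2.
Proof.
move=> fT mE PE mX X01 mu1 muM moments.
have [T01 Tnd _] := fT.
have mI : measurable (unit_itv R) by exact: measurable_itv.
have I01 (x : R) : unit_itv R x -> 0 <= x <= 1.
  by rewrite /unit_itv/= in_itv.
have mid : measurable_fun (unit_itv R) (id : R -> R) by exact: measurable_id.
pose tl (m : nat) := quad_lin f m (T (node m)).
pose tu (m : nat) := quad_lin f m (T (node m.+1)).
have up : \int[mu]_(x in unit_itv R) quad f x <=
    \int[mu]_(x in unit_itv R) simple_affine tl (quad_cst f) x.
  apply: le_Rintegral => //.
  - exact: (integrable_quad mI mu1 mid I01 fT).
  - exact: (integrable_simple_affine mI mu1 mid I01).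
  - by move=> x /I01; exact: quad_le.
have lo : \int[P]_(y in E) simple_affine tu (quad_cst f) (X y) <=
    \int[P]_(y in E) quad f (X y) + (4 * N%:R ^+ 2)^-1.
  have iq := integrable_quad mE PE mX X01 fT.
  have ic : P.-integrable E (EFin \o cst ((4 * N%:R ^+ 2)^-1 : R)).
    by apply: (@bounded_integrable _ _ _ _ _ _ `|(4 * N%:R ^+ 2)^-1|) => //;
      rewrite PE ltry.
  have -> : (4 * N%:R ^+ 2)^-1 = \int[P]_(y in E) (4 * N%:R ^+ 2)^-1 :> R.
    by rewrite Rintegral_cst// PE mulr1.
  rewrite -RintegralD//; apply: le_Rintegral => //.
  - exact: (integrable_simple_affine mE PE mX X01).
  - rewrite (_ : _ \o _ = (fun y => (quad f (X y))%:E +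
      ((4 * N%:R ^+ 2)^-1)%:E)%E)//; exact: integrableD.
  - by move=> y /X01; exact: quad_ge.
have NR : 0 < N%:R :> R by rewrite ltr0n.
(* The first cell exists because [N] is positive, and its mass is nonnegative. *)
have M0 : 0 <= M.
  rewrite -(pmulr_lge0 M (_ : 0 < N%:R^-1)) ?invr_gt0//.
  exact: le_trans (fine_ge0 (measure_ge0 _ _)) (muM (Ordinal N_gt0)).
have gap : \int[mu]_(x in unit_itv R) simple_affine tl (quad_cst f) x <=
    \int[P]_(y in E) simple_affine tu (quad_cst f) (X y) + 2 * M / N%:R ^+ 2.
  rewrite (Rintegral_simple_affine mE PE mX X01).
  rewrite (Rintegral_simple_affine mI mu1 mid I01).
  (* The factor 2 / N comes from [quad_lin] and M / N from the mass of a cell. *)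
  pose c := 2 * M / N%:R ^+ 2.
  have c0 : 0 <= c by rewrite divr_ge0 ?mulr_ge0 ?exprn_ge0// ltW.
  have tel : \sum_(m < N) (T (node m.+1) - T (node m)) * c <= c.
    rewrite -mulr_suml.
    rewrite -(big_mkord xpredT (fun m => T (node m.+1) - T (node m))).
    rewrite telescope_sumr// ler_piMl//.
    have /andP[_ TN] := T01 _ (node01 (leqnn N)).
    have /andP[T0 _] := T01 _ (node01 (leq0n N)).
    by rewrite lerBlDr (le_trans TN)// lerDl.
  apply: le_trans (lerD (lexx _) tel); rewrite -big_split ler_sum// => m _.
  (* The left end coefficients agree, so the [phi2] terms cancel. *)
  rewrite !moments//= -addrA [X in _ <= _ + X]addrC addrA lerD2r.
  have := le_trans (Rintegral_phi1_le m mu1) (muM m).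
  set p := \int[mu]_(x in _) _.
  have := Tnd _ _ (node01 (ltnW (ltn_ord m))) (node01 (ltn_ord m)).
  rewrite {1}nodeS ltrDl invr_gt0 => /(_ NR).
  rewrite /tl /tu /quad_lin /c -exprVn.
  have : 0 < N%:R^-1 :> R by rewrite invr_gt0.
  set v := N%:R^-1; set Ta := T (node m); set Tb := T (node m.+1).
  move=> v0 Tab pM; rewrite -subr_ge0.
  rewrite [leRHS](_ : _ = 2 * v * ((Tb - Ta) * (M * v - p))); last by ring.
  by rewrite !mulr_ge0 ?subr_ge0// ltW.
rewrite mulrDl -invfM; move: up lo gap; lra.
Qed.

End moment_stability.

(** * Bounded densities *)

Section density.
Context {R : realType}.
Local Notation leb := (@lebesgue_measure R).
Implicit Types (mu : probability (measurableTypeR R) R).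
Implicit Types (rho : measurableTypeR R -> R).

Lemma lebesgue_unit_itv : leb (unit_itv R) = 1%E.
Proof. by rewrite lebesgue_measure_itv/= lte_fin ltr01 sube0. Qed.

Lemma lebesgue01T : lebesgue01 R setT = 1%E.
Proof.
by rewrite -[LHS]/(leb (setT `&` `[0, 1]%classic)) setTI lebesgue_unit_itv.
Qed.

Lemma Linfty_norm_fin_num rho : nonneg_Linfty rho ->
  Linfty_norm rho \is a fin_num.
Proof.
by move=> [_ _ rhoy]; rewrite ge0_fin_numE//; exact: Lnorm_ge0.
Qed.

Lemma ae_le_Linfty_norm rho :
  {ae leb, forall x, unit_itv R x -> (`|rho x|%:E <= Linfty_norm rho)%E}.
Proof.
have : {ae lebesgue01 R, forall x, (`|rho x|%:E <= Linfty_norm rho)%E}.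
  (* The norm of order [+oo] unfolds to an essential supremum only when the total mass is
     positive. *)
  rewrite /Linfty_norm unlock lebesgue01T lte01.
  exact: (ess_sup_ge (lebesgue01 R) (abse \o (EFin \o rho))).
(* A null set of the restricted measure becomes Lebesgue null after intersection with [0, 1]. *)
move=> [Z [mZ Z0 subZ]]; exists (Z `&` unit_itv R); split => //.
- by apply: measurableI => //; exact: measurable_itv.
- move=> x /= /not_implyP[Ix nx]; split => //; exact: subZ.
Qed.

Lemma density_le mu rho : nonneg_Linfty rho -> has_density mu rho ->
  forall A, measurable A -> A `<=` unit_itv R ->
    (mu A <= Linfty_norm rho * leb A)%E.
Proof.
move=> Lrho drho A mA AI; rewrite drho//; have [mrho rho0 _] := Lrho.
rewrite -integral_cst//; apply: ae_ge0_le_integral => //.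
- by move=> x Ax; rewrite lee_fin rho0//; exact: AI.
- apply/measurable_EFinP; apply: measurable_funS mrho => //.
  exact: measurable_itv.
- by move=> x _; exact: Lnorm_ge0.
have := ae_le_Linfty_norm rho; apply: filterS => x rhox Ax.
by apply: le_trans (rhox (AI _ Ax)); rewrite lee_fin ler_norm.
Qed.

Lemma Linfty_norm_ge1 mu rho : probability_on (unit_itv R) mu ->
  nonneg_Linfty rho -> has_density mu rho -> (1 <= Linfty_norm rho)%E.
Proof.
move=> mu1 Lrho drho.
have mI : measurable (unit_itv R) by exact: measurable_itv.
have := density_le Lrho drho mI (fun _ => id).
by rewrite lebesgue_unit_itv mule1 (mu1 : mu (unit_itv R) = 1%E).
Qed.

End density.

(** * Distribution functions and the monotone map *)

Section monotone_map.
Context {R : realType}.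
Local Notation leb := (@lebesgue_measure R).
Implicit Types (mu nu : probability (measurableTypeR R) R).

Definition cdfR mu (x : R) : R := fine (mu `]-oo, x]%classic).

Lemma cdfRE mu x : mu `]-oo, x]%classic = (cdfR mu x)%:E.
Proof. by rewrite fineK// fin_num_measure. Qed.

Lemma cdfR_nd mu : nondecreasing_fun (cdfR mu).
Proof.
move=> x y xy; rewrite fine_le ?fin_num_measure//.
by rewrite le_measure ?inE//; exact: subset_itvl.
Qed.

Lemma cdfR_ge0 mu x : 0 <= cdfR mu x.
Proof. exact: fine_ge0. Qed.

Lemma cdfR_le1 mu x : cdfR mu x <= 1.
Proof. by rewrite -lee_fin -cdfRE; exact: probability_le1. Qed.

Lemma cdfR_right_continuous mu : right_continuous (cdfR mu).
Proof.
(* [cdf] is attached to a random variable; here it is the identity. *)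
pose idR : measurableTypeR R -> R := idfun.
pose X := @MeasurableFun.Pack _ _ _ _ idR
  (MeasurableFun.Class (isMeasurableFun.Build _ _ _ _ idR
     (@measurable_id _ _ setT))).
move=> a; apply: fine_cvg; rewrite -cdfRE.
exact: (@cdf_right_continuous _ _ _ mu X a).
Qed.


Lemma cdfR_lt0 mu y : probability_on (unit_itv R) mu -> y < 0 -> cdfR mu y = 0.
Proof.
move=> mu1 y0; have mI : measurable (unit_itv R) by exact: measurable_itv.
have mC : mu (~` unit_itv R) = 0%:E.
  by rewrite probability_setC// (mu1 : mu (unit_itv R) = 1%E) subee.
apply: EFin_inj; rewrite -cdfRE; apply/eqP; rewrite eq_le measure_ge0 andbT.
rewrite -mC le_measure ?inE//; first exact: measurableC.
move=> x; rewrite /unit_itv/= !in_itv/= => xy; apply/negP.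
by rewrite negb_and -ltNge (le_lt_trans xy).
Qed.

Lemma cdfR_ge1 mu y : probability_on (unit_itv R) mu -> 1 <= y -> cdfR mu y = 1.
Proof.
move=> mu1 y1; have mI : measurable (unit_itv R) by exact: measurable_itv.
apply/eqP; rewrite eq_le cdfR_le1/= -lee_fin -cdfRE.
rewrite -(mu1 : mu (unit_itv R) = 1%E) le_measure ?inE//.
move=> x; rewrite /unit_itv/= !in_itv/= => /andP[_ x1].
exact: le_trans y1.
Qed.

Lemma cdfRB mu x y : x <= y -> mu `]x, y]%classic = (cdfR mu y - cdfR mu x)%:E.
Proof.
move=> xy; rewrite EFinB -!cdfRE.
have -> : `]x, y]%classic = `]-oo, y] `\` `]-oo, x] :> set R.
  by rewrite -[RHS]setCK setCD setCitvl setUC -[LHS]setCK setCitv.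
rewrite measureD ?setIidr//; first exact: subset_itvl.
by rewrite -ge0_fin_numE// fin_num_measure.
Qed.

Section regular.
Variables (mu : probability (measurableTypeR R) R) (M : R).
Hypothesis mu1 : probability_on (unit_itv R) mu.
Hypothesis muM : forall A, measurable A -> A `<=` unit_itv R ->
  (mu A <= M%:E * leb A)%E.

(** The bound by Lebesgue measure excludes an atom at 0, and there is no mass outside [0, 1]. *)
Lemma cdfR0 : cdfR mu 0 = 0.
Proof.
have m0 : mu [set 0] = 0%:E.
  apply/eqP; rewrite eq_le measure_ge0 andbT.
  have := @muM [set 0] (measurable_set1 _).
  rewrite lebesgue_measure_set1 mule0; apply => _ ->.
  by rewrite /unit_itv/= in_itv/= lexx ler01.
have mI : measurable (unit_itv R) by exact: measurable_itv.
have mC : mu (~` unit_itv R) = 0%:E.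
  by rewrite probability_setC// (mu1 : mu (unit_itv R) = 1%E) subee.
apply: EFin_inj; rewrite -cdfRE; apply/eqP; rewrite eq_le measure_ge0 andbT.
rewrite -[leRHS]adde0 -[X in (_ <= X + _)%E]m0 -[X in (_ <= _ + X)%E]mC.
have mCm := measurableC mI.
apply: le_trans (measureU2 _ _ _) => //; rewrite le_measure ?inE//.
  exact: measurableU.
move=> x; rewrite /unit_itv/= !in_itv/= le_eqVlt => /predU1P[->|x0].
  by left.
by right; apply/negP; rewrite negb_and -ltNge x0.
Qed.

Lemma cdfR_lipschitz (x z : R) : 0 <= x <= 1 -> 0 <= z <= 1 ->
  `|cdfR mu x - cdfR mu z| <= M * `|x - z|.
Proof.
move=> x01 z01; wlog xz : x z x01 z01 / x <= z.
  move=> H; have [/H|/ltW/H] := leP x z; first exact.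
  by rewrite distrC (distrC z); exact.
rewrite distrC ger0_norm ?subr_ge0 ?cdfR_nd//.
rewrite distrC ger0_norm ?subr_ge0//.
rewrite -lee_fin -cdfRB// EFinM.
have -> : (z - x)%:E = leb `]x, z]%classic.
  rewrite lebesgue_measure_itv/= lte_fin lt_neqAle xz andbT.
  by case: eqVneq => [->|]; rewrite ?subrr// EFinB.
apply: muM => // y; rewrite /unit_itv/= !in_itv/= => /andP[xy yz].
case/andP: x01 => x0 _; case/andP: z01 => _ z1.
by rewrite (le_trans x0 (ltW xy)) (le_trans yz).
Qed.

Lemma cdfR_IVT p : 0 <= p <= 1 -> exists2 x, 0 <= x <= 1 & cdfR mu x = p.
Proof.
move=> p01; have [||x] := @IVT R (cdfR mu) 0 1 p ler01.
(* The Lipschitz constant must be nonnegative there, hence the absolute value. *)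
- apply: (@lipschitz_within_continuous _ _ _ _ `|M|) => // x z x01 z01.
  by rewrite (le_trans (cdfR_lipschitz x01 z01))// ler_wpM2r// ler_norm.
- by rewrite cdfR0 (cdfR_ge1 mu1)// min_l// max_r.
- by rewrite in_itv/= => x01 xp; exists x.
Qed.

(** A continuous distribution function takes every level, so the sublevel set can be compared with
    half-lines ending at points of prescribed level. *)
Lemma cdfR_uniform p : 0 <= p <= 1 -> mu [set x | cdfR mu x <= p] = p%:E.
Proof.
move=> p01; have mF : measurable [set x : measurableTypeR R | cdfR mu x <= p].
  have := nondecreasing_measurable (measurableT : measurable [set: R])
    (cdfR_nd mu).
  move=> /(_ measurableT `]-oo, p]%classic (measurable_itv _)); rewrite setTI.
  by congr measurable; apply/seteqP; split=> x; rewrite /= in_itv.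
apply/eqP; rewrite eq_le; apply/andP; split.
(* The distribution function may be flat at level [p]; a point of level [p + e] lies to the right of
   the whole sublevel set. *)
- apply/lee_addgt0Pr => e e0; rewrite -EFinD.
  have [pe1|pe1] := leP 1 (p + e).
    by rewrite (le_trans (probability_le1 _ _)).
  have [|x _ xpe] := @cdfR_IVT (p + e).
    by case/andP: p01 => p0 _; rewrite (ltW pe1) addr_ge0// ltW.
  rewrite -xpe -cdfRE le_measure ?inE// => y /= yp; rewrite in_itv/= leNgt.
  apply/negP => xy; have := cdfR_nd mu (ltW xy); rewrite xpe.
  by apply/negP; rewrite -ltNge (le_lt_trans yp)// ltrDl.
- have [x _ xp] := cdfR_IVT p01.
  rewrite -[in leLHS]xp -cdfRE le_measure ?inE// => y /=.
  rewrite in_itv/= => yx.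
  by rewrite -xp cdfR_nd.
Qed.

End regular.

Lemma cdfR_inj (P Q : probability (measurableTypeR R) R) :
  (forall x, P `]-oo, x]%classic = Q `]-oo, x]%classic) ->
  forall A, measurable A -> P A = Q A.
Proof.
move=> PQ A mA.
(* The generating family closed under intersection consists of right half-lines, so one passes to
   complements. *)
have PCoy (S : probability (measurableTypeR R) R) x :
    S `]x, +oo[%classic = (1 - S `]-oo, x]%classic)%E.
  by rewrite -setCitvl probability_setC.
apply: (@measure_unique _ _ (measurableTypeR R)
  (@RGenOInfty.G R) (fun n => `]- n%:R, +oo[%classic) _ _ _ _ P Q _ _ A mA).
- exact: RGenOInfty.measurableE.
- move=> _ _ [x ->] [y ->]; exists (Num.max x y); apply/seteqP; split=> z /=.
    by rewrite !in_itv/= !andbT gt_max => -[-> ->].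
  by rewrite !in_itv/= !andbT gt_max => /andP[].
- by move=> n; exists (- n%:R).
- apply/seteqP; split=> // x _; exists (Num.truncn `|x|).+1 => //=.
  rewrite in_itv/= andbT ltrNl (le_lt_trans (ler_norm _))// normrN.
  exact: truncnS_gt.
- by move=> _ [x ->]; have := PCoy P x; rewrite PQ -PCoy.
- by move=> n; rewrite (le_lt_trans (probability_le1 _ _)) ?ltry.
Qed.

(* The generalized inverse of the distribution function of [nu] composed with
   the distribution function of [mu]. *)
Lemma monotone_map mu nu M : probability_on (unit_itv R) mu ->
  probability_on (unit_itv R) nu ->
  (forall A, measurable A -> A `<=` unit_itv R -> (mu A <= M%:E * leb A)%E) ->
  exists T : R -> R, [/\ nondecreasing_fun T, forall x, 0 <= T x <= 1 &
    forall A : set (measurableTypeR R), measurable A -> mu (T @^-1` A) = nu A].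
Proof.
move=> mu1 nu1 muM.
pose D x := [set y : R | 0 <= y <= 1 /\ cdfR mu x <= cdfR nu y].
have D1 x : D x 1 by split; rewrite ?ler01 ?lexx// (cdfR_ge1 nu1)// cdfR_le1.
have Dlb x : lbound (D x) 0 by move=> y [/andP[]].
have Dinf x : has_inf (D x) by split; [exists 1|exists 0].
pose T x := inf (D x).
have T01 x : 0 <= T x <= 1.
  apply/andP; split; first by apply: lb_le_inf => //; exists 1.
  by apply: ge_inf => //; exists 0.
(* Galois connection: right continuity of the distribution function of [nu] makes the infimum
   attained. *)
have Tle x y : 0 <= y <= 1 -> (T x <= y) = (cdfR mu x <= cdfR nu y).
  move=> y01; apply/idP/idP => [Txy|xy]; last first.
    by apply: ge_inf; [exists 0|split].
  have Fz z : y < z -> cdfR mu x <= cdfR nu z.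
    move=> yz; have [w [_ xw] wz] := inf_lt (Dinf x).1 (le_lt_trans Txy yz).
    by rewrite (le_trans xw)// cdfR_nd// ltW.
  have := @cdfR_right_continuous nu y; move/cvg_lim => <- //.
  apply: limr_ge.
    by apply/cvg_ex; exists (cdfR nu y); exact: cdfR_right_continuous.
  by near=> z; apply: Fz; near: z; exact: nbhs_right_gt.
have Tnd : nondecreasing_fun T.
  move=> x y xy; apply: lb_le_inf; first by exists 1.
  move=> z [z01 yz]; apply: ge_inf; first by exists 0.
  by split=> //; rewrite (le_trans _ yz)// cdfR_nd.
have mT : measurable_fun [set: measurableTypeR R]
    (T : measurableTypeR R -> measurableTypeR R).
  exact: nondecreasing_measurable.
exists T; split => // A mA.
pose Tf := @MeasurableFun.Pack _ _ _ _ _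
  (MeasurableFun.Class (isMeasurableFun.Build _ _ _ _ _ mT)).
(* For [y] in [0, 1] the preimage is a sublevel set of the distribution function of [mu], at level
   [cdfR nu y]. Elsewhere both sides are 0 or 1. *)
have GE y : mu (T @^-1` `]-oo, y]) = nu `]-oo, y]%classic.
  have -> : T @^-1` `]-oo, y] = [set x | T x <= y].
    by apply/seteqP; split=> x; rewrite /= in_itv.
  have [y0|y0] := ltP y 0.
    rewrite (cdfRE nu) (cdfR_lt0 nu1)// (_ : [set _ | _] = set0) ?measure0//.
    apply/seteqP; split=> // x /= Txy; have /andP[T0 _] := T01 x.
    by move: (le_lt_trans (le_trans T0 Txy) y0); rewrite ltxx.
  have [y1|/ltW y1] := leP y 1; last first.
    rewrite (cdfRE nu) (cdfR_ge1 nu1)// (_ : [set _ | _] = setT).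
      exact: probability_setT.
    apply/seteqP; split=> // x _ /=; have /andP[_ T1] := T01 x.
    exact: le_trans y1.
  rewrite cdfRE -(cdfR_uniform mu1 muM) ?cdfR_ge0 ?cdfR_le1//.
  by congr (mu _); apply/seteqP; split=> x /=; rewrite Tle// y0.
exact: (@cdfR_inj (distribution mu Tf) nu).
Unshelve. all: by end_near. Qed.

End monotone_map.

(** Change of variables along [h]. Since [f] is controlled only on [I], its extension by zero is
    integrated, and the preimage of [I] differs from [D] by a null set. *)
Lemma integral_transfer d1 d2 (X : measurableType d1) (Y : measurableType d2)
    (R : realType) (P : probability X R) (Q : {measure set Y -> \bar R})
    (h : X -> Y) (D : set X) (I : set Y) (f : Y -> R) (K : R) :
  measurable_fun setT h -> (forall A, measurable A -> P (h @^-1` A) = Q A) ->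
  measurable D -> measurable I -> D `<=` h @^-1` I -> P D = 1%E ->
  measurable_fun I f -> (forall y, I y -> `|f y| <= K) ->
  (\int[Q]_(y in I) (f y)%:E = \int[P]_(x in D) (f (h x))%:E)%E.
Proof.
move=> mh PQ mD mI DI PD mf fK.
have mg : measurable_fun setT (EFin \o (f \_ I)).
  by apply/measurable_EFinP; apply/(measurable_restrictT f mI).
have PDC : P (~` D) = 0%E by rewrite probability_setC// PD subee.
have mhI : measurable (h @^-1` I).
  by rewrite -[X in measurable X]setTI; exact: mh.
transitivity (\int[pushforward P h]_(y in I) (EFin \o (f \_ I)) y)%E.
  rewrite (@eq_measure_integral _ _ _ _ (pushforward P h)).
    by apply: eq_integral => y yI; rewrite /= patchE yI.
  by move=> A mA _; rewrite -PQ.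
have ig : P.-integrable (h @^-1` I) ((EFin \o (f \_ I)) \o h).
  apply: (@bounded_integrable _ _ _ _ _ ((f \_ I) \o h) K) => //.
  - by rewrite (le_lt_trans (probability_le1 _ _)) ?ltry.
  - by apply: measurableT_comp (measurable_funTS mh); apply/measurable_EFinP.
  - by move=> x /= Ix; rewrite patchE mem_set//; exact: fK.
rewrite integral_pushforward// (@negligible_integral _ _ _ _ _ (~` D))//.
- rewrite setDE setCK setIidr//; apply: eq_integral => x xD /=.
  by rewrite patchE mem_set//; apply: DI; exact: set_mem.
- exact: measurableC.
Qed.

(** * Transport plans and the two inequalities *)

Section transport.
Context {R : realType}.
Implicit Types (mu nu : probability (measurableTypeR R) R).
Local Notation RR := (measurableTypeR R * measurableTypeR R)%type.

Lemma measurable_unit_itv : measurable (unit_itv R).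
Proof. exact: measurable_itv. Qed.

Lemma measurable_unit_square : measurable (unit_square R).
Proof. by apply: measurableX; exact: measurable_unit_itv. Qed.

Lemma unit_itvP (x : R) : unit_itv R x <-> 0 <= x <= 1.
Proof. by rewrite /unit_itv/= in_itv. Qed.

(** Change of variables along each projection turns marginal constraints into moment constraints. *)
Lemma couplings_moment N mu nu : (0 < N)%N ->
  couplings mu nu `<=` moment_couplings N mu nu.
Proof.
move=> N0 pi [pi1 pifst pisnd]; split=> // m l /andP[m0 mN] l12.
have phi1 y : unit_itv R y -> `|phi N m l y| <= 1.
  move=> /unit_itvP y01; case: m m0 mN => // m _ mN.
  by have /andP[p0 p1] := phi01 N0 (Ordinal mN) y01 l12; rewrite ger0_norm.
split; apply/esym; apply: (integral_transfer (K := 1)) => //.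
- exact: measurable_unit_square.
- exact: measurable_unit_itv.
- by move=> z [].
- by apply: measurable_funTS; exact: measurable_phi.
- exact: measurable_unit_square.
- exact: measurable_unit_itv.
- by move=> z [].
- by apply: measurable_funTS; exact: measurable_phi.
Qed.

Lemma cell_mass N mu rho (m : nat) : (0 < N)%N ->
  nonneg_Linfty rho -> has_density mu rho ->
  fine (mu (unit_itv R `&` cell R N m.+1)) <= fine (Linfty_norm rho) / N%:R.
Proof.
move=> N0 Lrho drho; have NR : 0 < N%:R :> R by rewrite ltr0n.
have mIC := measurableI _ _ measurable_unit_itv (@measurable_cell R N m.+1).
rewrite -lee_fin fineK ?fin_num_measure// EFinM fineK ?Linfty_norm_fin_num//.
apply: le_trans (density_le Lrho drho mIC (@subIsetl _ _ _)) _.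
apply: lee_wpmul2l; first exact: Lnorm_ge0.
apply: (@le_trans _ _ (lebesgue_measure (cell R N m.+1))).
  by rewrite le_measure ?inE//; exact: measurable_cell.
rewrite /cell; case: m {mIC} => [|m] /=.
  by rewrite lebesgue_measure_itv/= lte_fin divr_gt0// sube0 mul1r.
rewrite lebesgue_measure_itv/= lte_fin ltr_pM2r ?invr_gt0//.
by rewrite ltrBlDr ltrDl ltr01 -EFinB -mulrBl subKr mul1r.
Qed.

Lemma cost_integrable (pi : probability RR R) : 
  pi.-integrable (unit_square R) (fun z => ((z.1 - z.2) ^+ 2)%:E).
Proof.
apply: (@bounded_integrable _ _ _ _ _ (fun z : RR => (z.1 - z.2) ^+ 2) 1) => //.
- exact: measurable_unit_square.
- rewrite (le_lt_trans (probability_le1 _ _)) ?ltry//.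
  exact: measurable_unit_square.
- apply: measurable_funTS; apply: measurable_funX.
  by apply: measurable_funB.
- move=> z [/unit_itvP/andP[x0 x1] /unit_itvP/andP[y0 y1]].
  rewrite ger0_norm ?sqr_ge0//; nra.
Qed.


Lemma bounded_quad (f T : R -> R) : subgradient f T ->
  exists K, forall x, unit_itv R x -> `|quad f x| <= K.
Proof.
move=> fT; exists (1 + 2 * (`|f 0| + 1)) => x /unit_itvP x01.
exact: quad_bound fT _ x01.
Qed.

Lemma W2sq_le_moment_cost N mu nu rho_mu rho_nu pi : (0 < N)%N ->
  probability_on (unit_itv R) mu -> probability_on (unit_itv R) nu ->
  nonneg_Linfty rho_mu -> nonneg_Linfty rho_nu ->
  has_density mu rho_mu -> has_density nu rho_nu ->
  moment_couplings N mu nu pi ->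
  (W2sq mu nu <= cost pi +
    (7 / 3 * ((fine (Linfty_norm rho_mu) + fine (Linfty_norm rho_nu))
              * (N%:R ^+ 2)^-1))%:E)%E.
Proof.
move=> N0 mu1 nu1 Lmu Lnu dmu dnu [pi1 pimom].
have mI := @measurable_unit_itv; have mS := measurable_unit_square.
set Mmu := fine _; set Mnu := fine _.
have muM A : measurable A -> A `<=` unit_itv R ->
    (mu A <= Mmu%:E * lebesgue_measure A)%E.
  by move=> mA AI; rewrite /Mmu fineK ?Linfty_norm_fin_num//; exact: density_le.
have [T [Tnd T01 Tmunu]] := monotone_map mu1 nu1 muM.
have [f fT] := monotone_primitive Tnd T01.
have [g [S [gS young younge]]] := subgradient_conjugate fT.
have mT : measurable_fun [set: measurableTypeR R]
    (T : measurableTypeR R -> measurableTypeR R).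
  exact: nondecreasing_measurable.
have T_unit : T @^-1` unit_itv R = setT.
  by apply/seteqP; split=> // x _; apply/unit_itvP.
pose h (x : measurableTypeR R) : RR := (x, T x).
have mh : measurable_fun setT h by apply: measurable_fun_pair.
pose H := @MeasurableFun.Pack _ _ _ _ h
  (MeasurableFun.Class (isMeasurableFun.Build _ _ _ _ h mh)).
pose pi0 : probability RR R := distribution mu H.
have h_square : h @^-1` unit_square R = unit_itv R.
  apply/seteqP; split=> x; first by case.
  by move=> Ix; split => //; apply/unit_itvP; exact: T01.
have pi0_coupling : couplings mu nu pi0.
  split.
  - rewrite /probability_on/= -[LHS]/(mu (h @^-1` unit_square R)) h_square.
    exact: mu1.
  - by move=> A mA.
  - by move=> A mA; rewrite -Tmunu.
(* Equality in Young's inequality holds on the graph of [T], which carries [pi0]. *)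
have cost0 : cost pi0 = (\int[mu]_(x in unit_itv R) quad f x +
    \int[nu]_(y in unit_itv R) quad g y)%:E.
  have [Kf fK] := bounded_quad fT; have [Kg gK] := bounded_quad gS.
  have -> : \int[nu]_(y in unit_itv R) quad g y =
      \int[mu]_(x in unit_itv R) quad g (T x).
    congr fine; apply: (integral_transfer (K := Kg)) => //.
    - by rewrite T_unit.
    - exact: measurable_quad gS.
  have -> : cost pi0 = (\int[mu]_(x in unit_itv R) ((x - T x) ^+ 2)%:E)%E.
    apply: (@integral_transfer _ _ _ _ _ mu pi0 h _ _
      (fun z : RR => (z.1 - z.2) ^+ 2) 1) => //.
    - by rewrite h_square.
    - apply: measurable_funTS; apply: measurable_funX.
      by apply: measurable_funB.
    - move=> z [/unit_itvP/andP[x0 x1] /unit_itvP/andP[y0 y1]].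
      by rewrite ger0_norm ?sqr_ge0//; nra.
  have iq1 : mu.-integrable (unit_itv R) (EFin \o (quad f \o id)).
    by apply: (integrable_quad _ _ _ _ fT) => // x /unit_itvP.
  have iq2 : mu.-integrable (unit_itv R) (EFin \o (quad g \o T)).
    by apply: (integrable_quad _ _ _ _ gS) => //; exact: measurable_funTS.
  rewrite -RintegralD// /Rintegral fineK.
    apply: eq_integral => x /set_mem/unit_itvP x01; congr EFin.
    by have := younge x x01; rewrite /quad; nra.
  by apply: integrable_fin_num => //; exact: (integrableD _ iq1 iq2).
(* Weak duality: Young's inequality is integrated against [pi], whose marginals need not be [mu] and
   [nu]. *)
have costpi : (( \int[pi]_(z in unit_square R) quad f z.1 +
    \int[pi]_(z in unit_square R) quad g z.2)%:E <= cost pi)%E.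
  have i1 : pi.-integrable (unit_square R) (EFin \o (quad f \o fst)).
    apply: (integrable_quad _ _ _ _ fT) => //; first exact: measurable_funTS.
    by move=> z [/unit_itvP].
  have i2 : pi.-integrable (unit_square R) (EFin \o (quad g \o snd)).
    apply: (integrable_quad _ _ _ _ gS) => //; first exact: measurable_funTS.
    by move=> z [_ /unit_itvP].
  rewrite -RintegralD// /Rintegral fineK.
    apply: le_integral => //; first exact: (integrableD _ i1 i2).
      exact: cost_integrable.
    move=> z /set_mem[/unit_itvP x01 /unit_itvP y01]; rewrite lee_fin.
    by have := young _ _ x01 y01; rewrite /quad; nra.
  by apply: integrable_fin_num => //; exact: (integrableD _ i1 i2).
have stab1 : \int[mu]_(x in unit_itv R) quad f x <=
    \int[pi]_(z in unit_square R) quad f z.1 + (2 * Mmu + 4^-1) / N%:R ^+ 2.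
  apply: (@moment_stability R N N0 _ _ pi (unit_square R) fst mu f T Mmu) => //.
  - exact: measurable_funTS.
  - by move=> z [/unit_itvP].
  - by move=> m; exact: cell_mass.
  - by move=> m l /(pimom m.+1 l (ltn_ord m))[mom _]; rewrite /Rintegral mom.
have stab2 : \int[nu]_(x in unit_itv R) quad g x <=
    \int[pi]_(z in unit_square R) quad g z.2 + (2 * Mnu + 4^-1) / N%:R ^+ 2.
  apply: (@moment_stability R N N0 _ _ pi (unit_square R) snd nu g S Mnu) => //.
  - exact: measurable_funTS.
  - by move=> z [_ /unit_itvP].
  - by move=> m; exact: cell_mass.
  - by move=> m l /(pimom m.+1 l (ltn_ord m))[_ mom]; rewrite /Rintegral mom.
have Mmu1 : 1 <= Mmu.
  by rewrite -lee_fin fineK ?Linfty_norm_fin_num//; exact: Linfty_norm_ge1 dmu.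
have Mnu1 : 1 <= Mnu.
  by rewrite -lee_fin fineK ?Linfty_norm_fin_num//; exact: Linfty_norm_ge1 dnu.
apply: (@le_trans _ _ (cost pi0)); first by apply: ereal_inf_lbound; exists pi0.
rewrite cost0; apply: le_trans (leeD2r _ costpi); rewrite -EFinD lee_fin.
have : 0 <= (N%:R ^+ 2)^-1 :> R by rewrite invr_ge0 exprn_ge0.
(* The two errors add up to [2 * (Mmu + Mnu) + 1 / 2], and [1 / 2 <= (Mmu + Mnu) / 3] because both
   norms are at least 1. *)
move: stab1 stab2; set v := (N%:R ^+ 2)^-1; nra.
Qed.

End transport.

Theorem corollary5p10 (R : realType)
    (mu nu : probability (measurableTypeR R) R)
    (rho_mu rho_nu : measurableTypeR R -> R)
    (hmu : probability_on (unit_itv R) mu)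
    (hnu : probability_on (unit_itv R) nu)
    (hrho_mu : nonneg_Linfty rho_mu)
    (hrho_nu : nonneg_Linfty rho_nu)
    (hdens_mu : has_density mu rho_mu)
    (hdens_nu : has_density nu rho_nu)
    (N : nat) (hN : (1 <= N)%N) :
  (I_MCOT N mu nu <= W2sq mu nu)%E /\
  (W2sq mu nu <=
     I_MCOT N mu nu
     + (7 / 3)%:E * ((Linfty_norm rho_mu + Linfty_norm rho_nu)
                     * ((N%:R ^+ 2)^-1)%:E))%E.
Proof.
split; first exact/ereal_inf_le_tmp/image_subset/couplings_moment.
rewrite -(fineK (Linfty_norm_fin_num hrho_mu)).
rewrite -(fineK (Linfty_norm_fin_num hrho_nu)).
(* The error is finite, so it can be moved across and the infimum bounded plan by plan. *)
rewrite -EFinD -!EFinM -leeBlDr//.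
apply/ereal_infP => _ [pi pi_mom <-]; rewrite leeBlDr//.
exact: W2sq_le_moment_cost.
Qed.
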